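(* (Noether's first isomorphism theorem.) In a prohomological category, for any morphism $f\colon X\to Y$, one has $$\operatorname{Im}(f)=\frac{X}{\ker(f)}.$$ That is, if $(H,e,h)=\ker(f)$ is the kernel of $f$ and $f=m\circ q$ is the factorisation of $f$ as a regular epimorphism $q\colon X\to\operatorname{Im}(f)$ followed by a monomorphism $m$, then $(e,h,q)$ is a short exact sequence.
   Context: A finitely complete category is propointed if it admits an initial object $0$ and the unique morphism $0\to1$ is a universal extremal epimorphism (an extremal epimorphism all of whose pullbacks are extremal epimorphisms). A prohomological category is a propointed regular category that is protomodular in the sense of Bourn (for every morphism $v\colon Y\to X$ the pullback functor from the category of split epimorphisms with chosen section over $X$ to that over $Y$ is conservative). In a category with an initial object $0$, the kernel of $f\colon X\to Y$ is the span $\ker(f)=(H,e\colon H\to0,h\colon H\to X)$ given by the pullback of $f$ along the unique morphism $!_Y\colon0\to Y$. A short exact sequence is a triple $(e\colon H\to0,\ h\colon H\to X,\ q\colon X\to Q)$ such that the square $q\circ h=!_Q\circ e$ commutes and is both a pullback and a pushout; in this case one writes $Q=X/(H,e,h)=X/H$. *)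

(* Defs.v *)
(* Morphisms are compared by Leibniz equality. The classical axioms are used
   only to build the change-of-base functors: proof irrelevance identifies
   morphisms of points with the same underlying morphism, and description
   extracts mediating morphisms of pullbacks. *)
From Stdlib Require Import Classical ClassicalEpsilon FinFun.

Set Implicit Arguments.
Unset Strict Implicit.
Unset Printing Implicit Defensive.

Declare Scope cat_scope.
Delimit Scope cat_scope with cat.
Open Scope cat_scope.

Record Category := {
  Ob :> Type;
  Hom : Ob -> Ob -> Type;
  idm : forall A, Hom A A;
  comp : forall A B D, Hom B D -> Hom A B -> Hom A D;
  comp_assoc : forall A B D E (h : Hom D E) (g : Hom B D) (f : Hom A B),
    comp h (comp g f) = comp (comp h g) f;
  comp_id_l : forall A B (f : Hom A B), comp (idm B) f = f;
  comp_id_r : forall A B (f : Hom A B), comp f (idm A) = f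
}.

Arguments Hom {c} A B.
Arguments idm {c} A.
Notation "g ∘ f" := (comp g f) (at level 40, left associativity) : cat_scope.

Record Functor (C D : Category) := {
  fobj :> C -> D;
  fmap : forall A B : C, Hom A B -> Hom (fobj A) (fobj B);
  fmap_id : forall A : C, fmap (idm A) = idm (fobj A);
  fmap_comp : forall (A B E : C) (g : Hom B E) (f : Hom A B),
    fmap (g ∘ f) = fmap g ∘ fmap f
}.

Definition is_iso (C : Category) (A B : C) (f : Hom A B) : Prop :=
  exists g : Hom B A, g ∘ f = idm A /\ f ∘ g = idm B.

Definition conservative (C D : Category) (F : Functor C D) : Prop :=
  forall (A B : C) (f : Hom A B), is_iso (fmap F f) -> is_iso f.

Definition mono (C : Category) (A B : C) (m : Hom A B) : Prop :=
  forall (T : C) (u v : Hom T A), m ∘ u = m ∘ v -> u = v.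

Definition epi (C : Category) (A B : C) (e : Hom A B) : Prop :=
  forall (T : C) (u v : Hom B T), u ∘ e = v ∘ e -> u = v.

Record Cone (J C : Category) (D : Functor J C) := {
  apex : C;
  leg : forall j : J, Hom apex (D j);
  leg_natural : forall (i j : J) (t : Hom i j), fmap D t ∘ leg i = leg j
}.

Definition is_limit (J C : Category) (D : Functor J C) (K : Cone D) : Prop :=
  forall L : Cone D,
    exists! u : Hom (apex L) (apex K), forall j : J, leg K j ∘ u = leg L j.

Definition finite_category (J : Category) : Prop :=
  Finite J /\ forall i j : J, Finite (Hom i j).

Definition finitely_complete (C : Category) : Prop :=
  forall J : Category, finite_category J ->
  forall D : Functor J C, exists K : Cone D, is_limit K.

Record InitialObject (C : Category) := {
  initial_ob :> C;
  from_initial : forall X : C, Hom initial_ob X;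
  from_initial_unique : forall (X : C) (u : Hom initial_ob X), u = from_initial X
}.

Record TerminalObject (C : Category) := {
  terminal_ob :> C;
  to_terminal : forall X : C, Hom X terminal_ob;
  to_terminal_unique : forall (X : C) (u : Hom X terminal_ob), u = to_terminal X
}.

(* The square with p1 on top, p2 on the left, f on the right, g at the bottom. *)
Definition is_pullback (C : Category) (A B D P : C)
    (f : Hom A D) (g : Hom B D) (p1 : Hom P A) (p2 : Hom P B) : Prop :=
  f ∘ p1 = g ∘ p2 /\
  forall (T : C) (a : Hom T A) (b : Hom T B), f ∘ a = g ∘ b ->
    exists! u : Hom T P, p1 ∘ u = a /\ p2 ∘ u = b.

Definition is_pushout (C : Category) (A B D P : C)
    (f : Hom A B) (g : Hom A D) (i1 : Hom B P) (i2 : Hom D P) : Prop :=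
  i1 ∘ f = i2 ∘ g /\
  forall (T : C) (b : Hom B T) (d : Hom D T), b ∘ f = d ∘ g ->
    exists! u : Hom P T, u ∘ i1 = b /\ u ∘ i2 = d.

Definition is_coequalizer (C : Category) (A B Q : C)
    (u v : Hom A B) (q : Hom B Q) : Prop :=
  q ∘ u = q ∘ v /\
  forall (T : C) (t : Hom B T), t ∘ u = t ∘ v -> exists! w : Hom Q T, w ∘ q = t.

Definition regular_epi (C : Category) (B Q : C) (q : Hom B Q) : Prop :=
  exists (A : C) (u v : Hom A B), is_coequalizer u v q.

Definition regular_category (C : Category) : Prop :=
  finitely_complete C /\
  (forall (X Y R : C) (f : Hom X Y) (p1 p2 : Hom R X),
     is_pullback f f p1 p2 ->
     exists (Q : C) (q : Hom X Q), is_coequalizer p1 p2 q) /\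
  (forall (A B D P : C) (f : Hom A D) (g : Hom B D) (p1 : Hom P A) (p2 : Hom P B),
     is_pullback f g p1 p2 -> regular_epi f -> regular_epi p2).

Definition extremal_epi (C : Category) (A B : C) (e : Hom A B) : Prop :=
  epi e /\
  forall (M : C) (m : Hom M B) (g : Hom A M), e = m ∘ g -> mono m -> is_iso m.

Definition universal_extremal_epi (C : Category) (A D : C) (e : Hom A D) : Prop :=
  extremal_epi e /\
  forall (B P : C) (g : Hom B D) (p1 : Hom P A) (p2 : Hom P B),
    is_pullback e g p1 p2 -> extremal_epi p2.

Definition propointed (C : Category) : Prop :=
  finitely_complete C /\
  exists (Z : InitialObject C) (T : TerminalObject C),
    universal_extremal_epi (from_initial Z T).

(* Split epimorphisms over X with a chosen section. *)
Record Point (C : Category) (X : C) := {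
  pt_ob : C;
  pt_proj : Hom pt_ob X;
  pt_sec : Hom X pt_ob;
  pt_split : pt_proj ∘ pt_sec = idm X
}.

Definition is_point_map (C : Category) (X : C) (A B : Point X)
    (f : Hom (pt_ob A) (pt_ob B)) : Prop :=
  pt_proj B ∘ f = pt_proj A /\ f ∘ pt_sec A = pt_sec B.

Definition PointHom (C : Category) (X : C) (A B : Point X) : Type :=
  { f : Hom (pt_ob A) (pt_ob B) | is_point_map f }.

Lemma PointHom_eq (C : Category) (X : C) (A B : Point X) (f g : PointHom A B) :
  proj1_sig f = proj1_sig g -> f = g.
Proof.
destruct f as [f Hf], g as [g Hg]; simpl; intros E; subst g.
f_equal; apply proof_irrelevance.
Qed.

Lemma point_id_subproof (C : Category) (X : C) (A : Point X) :
  is_point_map (A := A) (B := A) (idm (pt_ob A)).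
Proof. split; [apply comp_id_r | apply comp_id_l]. Qed.

Lemma point_comp_subproof (C : Category) (X : C) (A B D : Point X)
    (g : PointHom B D) (f : PointHom A B) :
  is_point_map (A := A) (B := D) (proj1_sig g ∘ proj1_sig f).
Proof.
destruct f as [f [f1 f2]], g as [g [g1 g2]]; simpl; split.
- now rewrite comp_assoc, g1.
- now rewrite <- comp_assoc, f2.
Qed.

Definition Pt (C : Category) (X : C) : Category.
Proof.
refine {|
  Ob := Point X;
  Hom := @PointHom C X;
  idm := fun A => exist _ (idm (pt_ob A)) (point_id_subproof A);
  comp := fun A B D g f =>
    exist _ (proj1_sig g ∘ proj1_sig f) (point_comp_subproof g f)
|}; intros; apply PointHom_eq; simpl.
- apply comp_assoc.
- apply comp_id_l.
- apply comp_id_r.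
Defined.

Record Pullback (C : Category) (A B D : C) (f : Hom A D) (g : Hom B D) := {
  pb_ob : C;
  pb_fst : Hom pb_ob A;
  pb_snd : Hom pb_ob B;
  pb_spec : is_pullback f g pb_fst pb_snd
}.

Section Lift.
Variables (C : Category) (A B D : C) (f : Hom A D) (g : Hom B D).
Variables (P : Pullback f g) (T : C) (a : Hom T A) (b : Hom T B).
Hypothesis ab : f ∘ a = g ∘ b.

Definition pb_lift : Hom T (pb_ob P) :=
  proj1_sig (constructive_definite_description _ (proj2 (pb_spec P) T a b ab)).

Lemma pb_lift_spec : pb_fst P ∘ pb_lift = a /\ pb_snd P ∘ pb_lift = b.
Proof. unfold pb_lift; now destruct (constructive_definite_description _ _). Qed.

End Lift.

Lemma pb_ext (C : Category) (A B D : C) (f : Hom A D) (g : Hom B D)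
    (P : Pullback f g) (T : C) (u v : Hom T (pb_ob P)) :
  pb_fst P ∘ u = pb_fst P ∘ v -> pb_snd P ∘ u = pb_snd P ∘ v -> u = v.
Proof.
intros E1 E2; destruct (pb_spec P) as [c univ].
assert (E : f ∘ (pb_fst P ∘ v) = g ∘ (pb_snd P ∘ v))
  by now rewrite !comp_assoc, c.
destruct (univ T _ _ E) as [w [_ Hw]].
transitivity w; [symmetry|]; now apply Hw.
Qed.

Section ChangeOfBase.
Variables (C : Category) (X Y : C) (v : Hom Y X).
Variable pb : forall A : Point X, Pullback (pt_proj A) v.

Lemma cob_sec_subproof (A : Point X) :
  pt_proj A ∘ (pt_sec A ∘ v) = v ∘ idm Y.
Proof. now rewrite comp_assoc, pt_split, comp_id_l, comp_id_r. Qed.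

Definition cob_ob (A : Point X) : Point Y := {|
  pt_ob := pb_ob (pb A);
  pt_proj := pb_snd (pb A);
  pt_sec := pb_lift (pb A) (cob_sec_subproof A);
  pt_split := proj2 (pb_lift_spec (pb A) (cob_sec_subproof A))
|}.

Lemma cob_map_subproof (A B : Point X) (f : PointHom A B) :
  pt_proj B ∘ (proj1_sig f ∘ pb_fst (pb A)) = v ∘ pb_snd (pb A).
Proof.
destruct f as [f [f1 f2]]; simpl.
rewrite comp_assoc, f1; apply (proj1 (pb_spec (pb A))).
Qed.

Lemma cob_map_point_subproof (A B : Point X) (f : PointHom A B) :
  is_point_map (A := cob_ob A) (B := cob_ob B)
    (pb_lift (pb B) (cob_map_subproof f)).
Proof.
destruct (pb_lift_spec (pb B) (cob_map_subproof f)) as [l1 l2].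
destruct (pb_lift_spec (pb A) (cob_sec_subproof A)) as [a1 a2].
destruct (pb_lift_spec (pb B) (cob_sec_subproof B)) as [b1 b2].
split; simpl; [exact l2|].
apply pb_ext; rewrite comp_assoc.
- rewrite l1, b1, <- comp_assoc, a1, comp_assoc.
  now rewrite (proj2 (proj2_sig f)).
- now rewrite l2, a2, b2.
Qed.

Definition cob_map (A B : Point X) (f : PointHom A B) :
    PointHom (cob_ob A) (cob_ob B) :=
  exist _ (pb_lift (pb B) (cob_map_subproof f)) (cob_map_point_subproof f).

Definition change_of_base : Functor (Pt X) (Pt Y).
Proof.
refine {|
  fobj := cob_ob : Pt X -> Pt Y;
  fmap := cob_map : forall A B : Pt X, Hom A B -> @Hom (Pt Y) (cob_ob A) (cob_ob B)
|}.
- intros A; apply PointHom_eq; simpl.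
  destruct (pb_lift_spec (pb A) (cob_map_subproof (idm (A : Pt X)))) as [l1 l2].
  apply pb_ext; [refine (eq_trans l1 _)|refine (eq_trans l2 _)]; simpl.
  + now rewrite comp_id_l, comp_id_r.
  + now rewrite comp_id_r.
- intros A B E g f; apply PointHom_eq; simpl.
  destruct (pb_lift_spec (pb E) (cob_map_subproof (g ∘ f))) as [l1 l2].
  destruct (pb_lift_spec (pb E) (cob_map_subproof g)) as [g1 g2].
  destruct (pb_lift_spec (pb B) (cob_map_subproof f)) as [f1 f2].
  apply pb_ext; [refine (eq_trans l1 _)|refine (eq_trans l2 _)]; simpl;
    rewrite comp_assoc.
  + now rewrite g1, <- 2!comp_assoc, f1.
  + now rewrite g2, f2.
Defined.

End ChangeOfBase.

(* The pullback functor is determined up to isomorphism, so conservativity is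
   required for every choice of pullbacks along v; when C has pullbacks such
   choices exist by the axiom of choice. *)
Definition protomodular (C : Category) : Prop :=
  forall (X Y : C) (v : Hom Y X) (pb : forall A : Point X, Pullback (pt_proj A) v),
    conservative (change_of_base pb).

Definition prohomological (C : Category) : Prop :=
  propointed C /\ regular_category C /\ protomodular C.

Definition is_kernel (C : Category) (Z : InitialObject C) (X Y : C) (f : Hom X Y)
    (H : C) (e : Hom H Z) (h : Hom H X) : Prop :=
  is_pullback f (from_initial Z Y) h e.

Definition short_exact (C : Category) (Z : InitialObject C) (H X Q : C)
    (e : Hom H Z) (h : Hom H X) (q : Hom X Q) : Prop :=
  q ∘ h = from_initial Z Q ∘ e /\
  is_pullback q (from_initial Z Q) h e /\
  is_pushout h e q (from_initial Z Q).

(* Main.v *)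
Require Import Defs.
From Stdlib Require Import Classical ClassicalEpsilon FinFun List.

(** The square is a pullback because m is monic.  For the pushout property,
    let (R, p1, p2) be the kernel pair of q, with diagonal s.  If b : X -> T
    satisfies b h = !_T e, then b p1 and b p2 agree on s and on the pullback of
    the point (R, p1, s) along h, whose elements are the pairs of elements of H
    with the same image in 0.  In a protomodular category these two maps into
    R are jointly epic, so b p1 = b p2, and b factors through q, which is the
    coequalizer of its kernel pair. *)

(** * Finite limits over bipartite shapes *)

(** A shape with sources [S], targets [T] and no composable pair of
    non-identity arrows; it covers both cospans and parallel pairs. *)
Section BipartiteShape.
Context {S T : Type} (E : S -> T -> Type).

Definition bip_hom (i j : S + T) : Type :=
  match i, j with
  | inl s, inl s' => s = s'
  | inl s, inr t => E s t
  | inr _, inl _ => Empty_set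
  | inr t, inr t' => t = t'
  end.

Definition bip_id (i : S + T) : bip_hom i i :=
  match i with inl s => eq_refl s | inr t => eq_refl t end.

Definition bip_comp (i j k : S + T) : bip_hom j k -> bip_hom i j -> bip_hom i k.
Proof.
destruct i as [s|t], j as [s'|t'], k as [s''|t'']; simpl; intros g f;
  try contradiction.
- exact (eq_trans f g).
- rewrite f; exact g.
- rewrite <- g; exact f.
- exact (eq_trans f g).
Defined.

Definition bip_cat : Category.
Proof.
refine {| Ob := S + T; Hom := bip_hom; idm := bip_id; comp := bip_comp |}.
- intros [s|t] [s'|t'] [s''|t''] [s'''|t''']; simpl; intros;
    subst; (reflexivity || contradiction).
- intros [s|t] [s'|t']; simpl; intros; subst; (reflexivity || contradiction).
- intros [s|t] [s'|t']; simpl; intros; subst; (reflexivity || contradiction).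
Defined.

(** The arrows between two sources, or between two targets, of the shape are equality proofs; proof
    irrelevance leaves at most one. *)
Lemma finite_eq (A : Type) (x y : A) : Finite (x = y).
Proof.
destruct (classic (x = y)) as [e|n].
- exists (e :: nil); intros e'; left; apply proof_irrelevance.
- exists nil; intros e; contradiction.
Qed.

Lemma bip_cat_finite :
  Finite S -> Finite T -> (forall s t, Finite (E s t)) -> finite_category bip_cat.
Proof.
intros [ls Hs] [lt Ht] HE; split.
- exists (map inl ls ++ map inr lt); intros [s|t]; apply in_or_app.
  + left; now apply in_map.
  + right; now apply in_map.
- intros [s|t] [s'|t']; simpl.
  + apply finite_eq.
  + apply HE.
  + exists nil; intros [].
  + apply finite_eq.
Qed.

Context {C : Category} (F : S -> C) (G : T -> C).
Context (phi : forall s t, E s t -> Hom (F s) (G t)).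

Definition bip_obj (i : S + T) : C :=
  match i with inl s => F s | inr t => G t end.

Definition bip_map (i j : S + T) : bip_hom i j -> Hom (bip_obj i) (bip_obj j).
Proof.
destruct i as [s|t], j as [s'|t']; simpl; intros f.
- destruct f; apply idm.
- exact (phi s t' f).
- contradiction.
- destruct f; apply idm.
Defined.

Definition bip_diagram : Functor bip_cat C.
Proof.
refine (@Build_Functor bip_cat C bip_obj bip_map _ _).
- intros [s|t]; reflexivity.
- intros [s|t] [s'|t'] [s''|t'']; simpl; intros g f; try contradiction;
    subst; simpl; now rewrite ?comp_id_l, ?comp_id_r.
Defined.

Definition bip_cone (L : C) (p : forall s, Hom L (F s)) (r : forall t, Hom L (G t))
    (H : forall s t (x : E s t), phi s t x ∘ p s = r t) : Cone bip_diagram.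
Proof.
refine (@Build_Cone bip_cat C bip_diagram L
  (fun j => match j return Hom L (bip_obj j) with inl s => p s | inr t => r t end) _).
intros [s|t] [s'|t']; simpl; intros x;
  try contradiction; try (subst; apply comp_id_l); apply H.
Defined.

(** Replaces functors and cones by plain families of legs. Compatibility is asked only along
    source-to-target arrows, since the others are identities. *)
Lemma bipartite_limit :
  finitely_complete C ->
  Finite S -> Finite T -> (forall s t, Finite (E s t)) ->
  exists (L : C) (p : forall s, Hom L (F s)) (r : forall t, Hom L (G t)),
    (forall s t (x : E s t), phi s t x ∘ p s = r t) /\
    forall (M : C) (p' : forall s, Hom M (F s)) (r' : forall t, Hom M (G t)),
      (forall s t (x : E s t), phi s t x ∘ p' s = r' t) ->
      exists! u : Hom M L,
        (forall s, p s ∘ u = p' s) /\ (forall t, r t ∘ u = r' t).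
Proof.
intros HC HS HT HE.
destruct (HC bip_cat (bip_cat_finite HS HT HE) bip_diagram) as [K HK].
exists (apex K), (fun s => leg K (inl s : bip_cat)),
  (fun t => leg K (inr t : bip_cat)); split.
- intros s t x.
  exact (leg_natural K (i := inl s : bip_cat) (j := inr t : bip_cat) x).
- intros M p' r' H'.
  destruct (HK (bip_cone M p' r' H')) as [u [Hu Uu]].
  exists u; split.
  + split; [intros s; exact (Hu (inl s)) | intros t; exact (Hu (inr t))].
  + intros w [w1 w2]; apply Uu; intros [s|t]; [apply w1 | apply w2].
Qed.

End BipartiteShape.

(** * Pullbacks and equalizers *)

Lemma finite_unit : Finite unit.
Proof. exists (tt :: nil); intros []; now left. Qed.

Lemma finite_bool : Finite bool.
Proof. exists (true :: false :: nil); intros []; simpl; auto. Qed.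

Lemma finitely_complete_pullback {C : Category} (HC : finitely_complete C)
    {A B D : C} (f : Hom A D) (g : Hom B D) : inhabited (Pullback f g).
Proof.
set (F := fun s : bool => if s then A else B).
set (phi := fun (s : bool) (_ : unit) (_ : unit) =>
  match s return Hom (F s) D with true => f | false => g end).
destruct (bipartite_limit (fun _ _ => unit) F (fun _ => D) phi HC
  finite_bool finite_unit (fun _ _ => finite_unit)) as (L & p & r & Hp & U).
constructor; refine {| pb_fst := p true : Hom L A; pb_snd := p false : Hom L B |}.
split.
- transitivity (r tt); [exact (Hp true tt tt) | symmetry; exact (Hp false tt tt)].
- intros M a b ab.
  (* The leg to the single target has to be the common composite. *)
  destruct (U M (fun s => match s return Hom M (F s) with true => a | false => b end)
    (fun _ => g ∘ b)) as [u [[u1 u2] Uu]].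
  { intros [] [] []; [exact ab | reflexivity]. }
  exists u; split.
  + split; [exact (u1 true) | exact (u1 false)].
  + intros w [w1 w2]; apply Uu; split.
    * intros []; assumption.
    * intros []; rewrite <- (Hp false tt tt), <- comp_assoc.
      exact (f_equal (comp g) w2).
Qed.

Lemma finitely_complete_equalizer {C : Category} (HC : finitely_complete C)
    {A B : C} (a b : Hom A B) :
  exists (M : C) (j : Hom M A), mono j /\ a ∘ j = b ∘ j /\
    forall (T : C) (x : Hom T A), a ∘ x = b ∘ x -> exists y : Hom T M, j ∘ y = x.
Proof.
destruct (bipartite_limit (fun _ _ => bool) (fun _ : unit => A) (fun _ : unit => B)
  (fun _ _ (i : bool) => if i then a else b) HC
  finite_unit finite_unit (fun _ _ => finite_bool)) as (M & p & r & Hp & U).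
pose proof (Hp tt tt true) as Ha; pose proof (Hp tt tt false) as Hb; simpl in Ha, Hb.
exists M, (p tt); split; [|split].
- intros T u v E.
  destruct (U T (fun _ => p tt ∘ v) (fun _ => r tt ∘ v)) as [w [_ Hw]].
  { intros [] [] []; now rewrite comp_assoc, ?Ha, ?Hb. }
  transitivity w; [symmetry|]; apply Hw; split; intros []; try easy.
  now rewrite <- Ha, <- !comp_assoc, E.
- now rewrite Ha, Hb.
- intros T x E.
  destruct (U T (fun _ => x) (fun _ => a ∘ x)) as [w [[w1 _] _]].
  { intros [] [] []; easy. }
  exists w; apply w1.
Qed.

(** * Points and protomodularity *)

(** An inverse in [C] automatically respects projections and sections. *)
Lemma point_iso {C : Category} {X : C} {A B : Pt X} (f : Hom A B)
    (g : Hom (pt_ob B) (pt_ob A)) :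
  g ∘ proj1_sig f = idm (pt_ob A) -> proj1_sig f ∘ g = idm (pt_ob B) -> is_iso f.
Proof.
destruct f as [f [f1 f2]]; simpl; intros gf fg.
assert (Hg : is_point_map (A := B) (B := A) g).
{ split.
  - now rewrite <- f1, <- comp_assoc, fg, comp_id_r.
  - now rewrite <- f2, comp_assoc, gf, comp_id_l. }
exists (exist _ g Hg); split; now apply PointHom_eq.
Qed.

Section JointlyEpic.
Context {C : Category} (HC : finitely_complete C) (HP : protomodular C).

(** The hypothesis [Hv] says, in terms of generalized elements, that the mono
    [j] becomes invertible after pulling back along [v]. *)
Lemma protomodular_mono_iso {X Y : C} (v : Hom Y X) (A B : Point X)
    (j : Hom (pt_ob A) (pt_ob B)) (Hj : is_point_map j) (Mj : mono j)
    (Hv : forall (T : C) (x : Hom T (pt_ob B)) (y : Hom T Y),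
       pt_proj B ∘ x = v ∘ y -> exists z : Hom T (pt_ob A), j ∘ z = x) :
  is_iso j.
Proof.
(* [protomodular] expects chosen pullbacks; [epsilon] with a trivial predicate extracts them from
   mere existence. *)
set (pb := fun D : Point X =>
  epsilon (finitely_complete_pullback HC (pt_proj D) v) (fun _ => True)).
set (jj := exist _ j Hj : @Hom (Pt X) A B).
enough (Hiso : is_iso jj).
{ destruct Hiso as [g [g1 g2]]; exists (proj1_sig g); split.
  - exact (f_equal (@proj1_sig _ _) g1).
  - exact (f_equal (@proj1_sig _ _) g2). }
apply (HP X Y v pb).
(* Applied to the universal element, [Hv] factors [pb_fst (pb B)] through [j]; the factor [n] lifts
   to the inverse of the pulled-back [j]. *)
destruct (Hv _ (pb_fst (pb B)) (pb_snd (pb B)) (proj1 (pb_spec (pb B))))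
  as [n Hn].
assert (En : pt_proj A ∘ n = v ∘ pb_snd (pb B)).
{ rewrite <- (proj1 Hj), <- comp_assoc, Hn; apply (proj1 (pb_spec (pb B))). }
destruct (pb_lift_spec (pb A) En) as [n1 n2].
destruct (pb_lift_spec (pb B) (cob_map_subproof pb jj)) as [l1 l2].
apply (point_iso (A := cob_ob pb A) (B := cob_ob pb B) (cob_map pb jj)
  (pb_lift (pb A) En)); simpl; apply pb_ext; rewrite comp_assoc, comp_id_r.
- apply Mj; rewrite n1, comp_assoc, Hn; exact l1.
- now rewrite n2.
- refine (eq_trans (f_equal (fun t => t ∘ _) l1) _); simpl; now rewrite <- comp_assoc, n1.
- exact (eq_trans (f_equal (fun t => t ∘ _) l2) n2).
Qed.

(** The equalizer [j] of [a] and [b] contains the section, hence is itself a point over [X], and it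
    contains everything lying over [v]. So [j] is invertible by [protomodular_mono_iso]. *)
Lemma protomodular_jointly_epic {X Y : C} (v : Hom Y X) (A : Point X)
    {T : C} (a b : Hom (pt_ob A) T)
    (Hs : a ∘ pt_sec A = b ∘ pt_sec A)
    (Hv : forall (S : C) (x : Hom S (pt_ob A)) (y : Hom S Y),
       pt_proj A ∘ x = v ∘ y -> a ∘ x = b ∘ x) :
  a = b.
Proof.
destruct (finitely_complete_equalizer HC a b) as (M & j & Mj & Ej & Uj).
destruct (Uj _ _ Hs) as [s Es].
assert (split_s : (pt_proj A ∘ j) ∘ s = idm X)
  by (rewrite <- comp_assoc, Es; apply pt_split).
set (B := {| pt_split := split_s |}).
assert (Hj : is_point_map (A := B) (B := A) j) by now split.
destruct (protomodular_mono_iso v B A j Hj Mj) as [g [_ jg]].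
{ intros S x y E; exact (Uj S x (Hv S x y E)). }
rewrite <- (comp_id_r a), <- (comp_id_r b), <- jg, !comp_assoc;
  exact (f_equal (fun t => t ∘ g) Ej).
Qed.

End JointlyEpic.

(** * Kernels and kernel pairs *)

Lemma initial_hom_eq {C : Category} (Z : InitialObject C) {X : C} (u v : Hom Z X) :
  u = v.
Proof. now rewrite (from_initial_unique u), (from_initial_unique v). Qed.

(** Maps out of [Z] are unique and [m] is monic, so the same squares commute for [q] as for
    [m ∘ q]. *)
Lemma kernel_mono_comp {C : Category} (Z : InitialObject C) {X I Y H : C}
    (q : Hom X I) (m : Hom I Y) (e : Hom H Z) (h : Hom H X) :
  mono m -> is_kernel (m ∘ q) e h -> is_kernel q e h.
Proof.
intros Hm [c U]; split.
- apply Hm; rewrite !comp_assoc, c; f_equal; apply initial_hom_eq.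
- intros T a b E; apply U.
  rewrite <- comp_assoc, E, comp_assoc; f_equal; apply initial_hom_eq.
Qed.

(** The pair that [q] coequalizes factors through the kernel pair [P], so [b] identifies that pair
    too. *)
Lemma regular_epi_factor {C : Category} {X Q T : C} (q : Hom X Q) (b : Hom X T)
    (P : Pullback q q) :
  regular_epi q -> b ∘ pb_fst P = b ∘ pb_snd P -> exists! u : Hom Q T, u ∘ q = b.
Proof.
intros (A & u & v & E & U) Eb; apply U.
destruct (pb_lift_spec P E) as [l1 l2].
transitivity (b ∘ pb_fst P ∘ pb_lift P E).
- now rewrite <- comp_assoc, l1.
- now rewrite Eb, <- comp_assoc, l2.
Qed.

Lemma kernel_equalizes_kernel_pair {C : Category} (HC : finitely_complete C)
    (HP : protomodular C) (Z : InitialObject C) {X Q H T : C} (q : Hom X Q)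
    (e : Hom H Z) (h : Hom H X) (b : Hom X T) (d : Hom Z T) (P : Pullback q q) :
  is_kernel q e h -> b ∘ h = d ∘ e -> b ∘ pb_fst P = b ∘ pb_snd P.
Proof.
intros [c U] Eb.
(* The lift of the two identities is the diagonal, the section of the point [A]. *)
destruct (pb_lift_spec P (eq_refl (q ∘ idm X))) as [s1 s2].
set (A := {| pt_split := s1 |}).
apply (protomodular_jointly_epic HC HP h A).
- simpl; now rewrite <- !comp_assoc, s1, s2.
- simpl; intros S x k Ek.
  (* The first component of [x] is [h ∘ k]. The second has the same image under [q], hence is
     [h ∘ k'] with [e ∘ k' = e ∘ k]; [b] sends both to [d ∘ e ∘ k]. *)
  assert (E : q ∘ (pb_snd P ∘ x) = from_initial Z Q ∘ (e ∘ k)).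
  { rewrite comp_assoc, <- (proj1 (pb_spec P)), <- comp_assoc, Ek.
    now rewrite !comp_assoc, c. }
  destruct (U S _ _ E) as [k' [[h1 h2] _]].
  now rewrite <- !comp_assoc, Ek, <- h1, !comp_assoc, Eb, <- !comp_assoc, h2.
Qed.

Theorem theorem5p15 (C : Category) (HC : prohomological C) (Z : InitialObject C)
    (X Y : C) (f : Hom X Y)
    (H : C) (e : Hom H Z) (h : Hom H X) (Hker : is_kernel f e h)
    (I : C) (q : Hom X I) (m : Hom I Y)
    (Hq : regular_epi q) (Hm : mono m) (Hf : f = comp m q) :
  short_exact e h q.
Proof.
subst f.
pose proof (kernel_mono_comp Z q m e h Hm Hker) as Kq.
destruct HC as [[FC _] [_ HP]].
split; [exact (proj1 Kq) | split; [exact Kq | split; [exact (proj1 Kq) |]]].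
intros T b d Eb.
destruct (finitely_complete_pullback FC q q) as [P].
destruct (regular_epi_factor q b P Hq
  (kernel_equalizes_kernel_pair FC HP Z q e h b d P Kq Eb)) as [u [Hu Uu]].
exists u; split.
- split; [exact Hu | apply initial_hom_eq].
- intros w [Hw _]; now apply Uu.
Qed.
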